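(* For the merging problem with $n$ items and $k$ slots, suppose $2k\le n$ and the ad values $a_1,\dots,a_n$ are i.i.d. with a common (regular) distribution $G$ supported on $[0,\infty)$, and $o_i\ge 0$. Then the G-FIX mechanism is $\binom{n-k}{k}/\binom{n}{k}$-approximate: $\mathrm{OBJ}(\mathcal M^F)\ge \frac{\binom{n-k}{k}}{\binom{n}{k}}\mathrm{OBJ}(\mathcal M^* )$.
   Context: Merging problem: $n$ items indexed by $[n]$, $k\le n$ slots. Each item $i$ has a random ad value $a_i$, drawn independently from a regular distribution $G_i$ ($\boldsymbol a\sim G=\times_i G_i$), and a fixed organic value $o_i\ge0$. A mechanism is a pair of allocation rules $x,y$ with $x_i(\boldsymbol a),y_i(\boldsymbol a)\in\{0,1\}$ ($x_i=1$: item $i$ shown as ad; $y_i=1$: shown organically) satisfying for all $\boldsymbol a,i$: (i) $\sum_i(x_i+y_i)\le k$; (ii) $x_i+y_i\le 1$; (iii) $y_i(a_i,\boldsymbol a_{-i})$ independent of $a_i$; (iv) $x_i(a_i,\boldsymbol a_{-i})$ non-decreasing in $a_i$. Objective $\mathrm{OBJ}=\mathbb E_{\boldsymbol a\sim G}[\sum_i(a_ix_i(\boldsymbol a)+o_iy_i(\boldsymbol a))]$; $\mathcal M^*$ maximizes it subject to (i)–(iv). A mechanism $\mathcal M$ is $\tau$-approximate if $\mathrm{OBJ}(\mathcal M)/\mathrm{OBJ}(\mathcal M^* )\ge\tau$. Notation: for a finite multiset $S$ of reals and $k\le|S|$, $\max^{(k)}S$ is the sum of the $k$ largest elements of $S$.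 G-FIX-$I$ mechanism $\mathcal M^F_I$ for $I\subseteq[n]$: items in $I$ may only be shown in organic form and items outside $I$ only as ads; with $L=\{o_i:i\in I\}\cup\{a_i:i\in[n]\setminus I\}$, it displays (in the designated forms) the $k$ items with the largest values in $L$, i.e. $x_i(\boldsymbol a)=1$ iff $i\notin I$ and $a_i>\max^{(k+1)}L-\max^{(k)}L$, $y_i(\boldsymbol a)=1$ iff $i\in I$ and $o_i>\max^{(k+1)}L-\max^{(k)}L$. Its objective is $\mathrm{OBJ}(\mathcal M_I^F)=\mathbb E_{\boldsymbol a\sim G}[\max^{(k)}L]$. The G-FIX mechanism $\mathcal M^F$ runs the $\mathcal M^F_I$ with the highest objective among all $I\subseteq[n]$ with $|I|\le k$, so $\mathrm{OBJ}(\mathcal M^F)=\max_{I\subseteq[n],|I|\le k}\mathrm{OBJ}(\mathcal M^F_I)$. *)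

(* Defs.v *)
From HB Require Import structures.
From mathcomp Require Import all_boot all_order all_algebra.
From mathcomp Require Import all_classical all_reals all_analysis.
Set Implicit Arguments. Unset Strict Implicit. Unset Printing Implicit Defensive.
Import Order.TTheory GRing.Theory Num.Theory.
Local Open Scope classical_set_scope.
Local Open Scope ring_scope.

Definition topk {R : realDomainType} (k : nat) (s : seq R) : R :=
  \sum_(j < k) nth 0 (sort (fun u v : R => v <= u) s) j.

Definition rule (R : realType) (n : nat) := ('I_n -> R) -> 'I_n -> bool.

(* the profile v with coordinate i replaced, expressed as "agree off i" *)
Definition agree_off (R : realType) (n : nat) (i : 'I_n) (v w : 'I_n -> R) :=
  forall j, j != i -> v j = w j.

Definition is_mechanism (R : realType) (n k : nat) (x y : rule R n) : Prop :=
  [/\ (forall v, (\sum_(i < n) (x v i + y v i : nat) <= k)%N),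
      (forall v i, ~~ (x v i && y v i)),
      (forall v w i, agree_off i v w -> y v i = y w i) &
      (forall v w i, agree_off i v w -> v i <= w i -> x v i -> x w i)].

Definition profile (d : measure_display) (T : measurableType d) (R : realType)
  (n : nat) (a : 'I_n -> T -> R) (w : T) : 'I_n -> R := fun i => a i w.

Definition OBJ (d : measure_display) (T : measurableType d) (R : realType)
  (P : probability T R) (n : nat) (a : 'I_n -> T -> R) (o : 'I_n -> R)
  (x y : rule R n) : \bar R :=
  (\int[P]_w (\sum_(i < n) (a i w * (x (profile a w) i)%:R
                           + o i * (y (profile a w) i)%:R))%:E)%E.

Definition Lvals (R : realType) (n : nat) (I : {set 'I_n}) (o v : 'I_n -> R) : seq R :=
  [seq (if i \in I then o i else v i) | i <- enum 'I_n].

Definition OBJ_FIX (d : measure_display) (T : measurableType d) (R : realType)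
  (P : probability T R) (n k : nat) (a : 'I_n -> T -> R) (o : 'I_n -> R)
  (I : {set 'I_n}) : \bar R :=
  (\int[P]_w (topk k (Lvals I o (profile a w)))%:E)%E.

Definition OBJ_GFIX (d : measure_display) (T : measurableType d) (R : realType)
  (P : probability T R) (n k : nat) (a : 'I_n -> T -> R) (o : 'I_n -> R) : \bar R :=
  (\big[maxe/-oo]_(I : {set 'I_n} | (#|I| <= k)%N) OBJ_FIX P k a o I)%E.

Definition mutually_independent (d : measure_display) (T : measurableType d)
  (R : realType) (P : probability T R) (n : nat) (a : 'I_n -> T -> R) : Prop :=
  forall B : 'I_n -> set R, (forall i, measurable (B i)) ->
    P (\bigcap_(i in [set: 'I_n]) (a i @^-1` B i)) =
    (\prod_(i < n) P (a i @^-1` B i))%E.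

(* G is regular: it has a Lebesgue density g, and the virtual value
   phi(v) = v - (1 - F(v)) / g(v) is non-decreasing on the support {g > 0}. *)
Definition cdf (R : realType) (G : probability R R) (v : R) : R :=
  fine (G [set u : R | u <= v]).

Definition regular (R : realType) (G : probability R R) : Prop :=
  exists g : R -> R,
    [/\ (forall u, 0 <= g u), measurable_fun setT g,
        (forall A, measurable A -> G A = (\int[lebesgue_measure]_(u in A) (g u)%:E)%E) &
        (forall u v, 0 < g u -> 0 < g v -> u <= v ->
           u - (1 - cdf G u) / g u <= v - (1 - cdf G v) / g v)].

Definition gfix_ratio (R : realType) (n k : nat) : R :=
  ('C(n - k, k))%:R / ('C(n, k))%:R.

(* Main.v *)
(* Let I be the set of the k largest organic values. For any profile, let A be
   the set of the k largest ad values. If A misses I, then the G-FIX-I mechanism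
   already has at its disposal the k best organic items and the k best ads, so
   it does as well on this profile as any mechanism. The ad values are
   exchangeable, so I may be replaced by a uniformly random k-set J in this
   comparison, and J misses A with probability C(n-k,k) / C(n,k). *)
Require Import Defs.
From HB Require Import structures.
From mathcomp Require Import all_boot all_order all_algebra.
Import Order.TTheory GRing.Theory Num.Theory.
Local Open Scope ring_scope.

(** * Sums of the [k] largest values as sums over index sets *)

Lemma exists_subset_card (T : finType) (B : {set T}) (m : nat) :
  (m <= #|B|)%N -> exists2 A : {set T}, A \subset B & #|A| = m.
Proof.
rewrite -bin_gt0 -cards_draws => /card_gt0P[A].
by rewrite inE => /andP[sAB /eqP cA]; exists A.
Qed.

(** [topk] sorts values and forgets which items they belong to. Sorting the indices by [f] instead
    makes the first [k] of them a set [T] that can be compared with other index sets. *)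
Lemma topk_top_set {R : realDomainType} (n k : nat) (f : 'I_n -> R) :
  (k <= n)%N ->
  exists T : {set 'I_n}, [/\ #|T| = k,
    (forall i j, i \in T -> j \notin T -> f j <= f i) &
    topk k [seq f i | i <- enum 'I_n] = \sum_(i in T) f i].
Proof.
move=> kn; pose ge u v : bool := (f v <= f u).
pose t := sort ge (enum 'I_n).
have t_uniq : uniq t by rewrite sort_uniq enum_uniq.
have st : size t = n by rewrite size_sort size_enum_ord.
have memt i : i \in t by rewrite mem_sort mem_enum.
have t_sorted : pairwise ge t.
  rewrite -sorted_pairwise; last by move=> u v w /[swap]; exact: le_trans.
  by apply: sort_sorted => u v; exact: le_total.
have topE : topk k [seq f i | i <- enum 'I_n] = \sum_(i <- take k t) f i.
  rewrite /topk sort_map -/t; case: n f kn ge t t_uniq st memt t_sorted.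
    move=> f; rewrite leqn0 => /eqP -> ge t _ _ _ _.
    by rewrite big_ord0 take0 big_nil.
  move=> n f kn ge t _ st _ _.
  rewrite (big_nth ord0) size_takel ?st// big_mkord; apply: eq_bigr => i _.
  by rewrite nth_take// (nth_map ord0)// st (leq_trans (ltn_ord i)).
exists [set i in take k t]; split.
- rewrite cardsE; have /card_uniqP -> := take_uniq k t_uniq.
  by rewrite size_takel// st.
- move=> i j; rewrite !inE => it jt; move: t_sorted.
  rewrite -(cat_take_drop k t) pairwise_cat => /and3P[/allrelP + _ _]; apply=> //.
  by move: (memt j); rewrite -{1}(cat_take_drop k t) mem_cat (negbTE jt).
- rewrite topE big_uniq/=; last exact: take_uniq.
  by apply: eq_bigl => i; rewrite inE.
Qed.

(** An exchange argument: the elements of [X] outside [T] are traded for equally many elements of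
    [T] outside [X], on which [f] is at least as large. *)
Lemma sum_le_top_set {R : realDomainType} (I : finType) (f : I -> R) (T X : {set I}) :
  (forall i j, i \in T -> j \notin T -> f j <= f i) -> (#|X| <= #|T|)%N ->
  exists X' : {set I}, [/\ X' \subset T, #|X'| = #|X| &
    \sum_(i in X) f i <= \sum_(i in X') f i].
Proof.
move=> topT cXT.
have cD : (#|X :\: T| <= #|T :\: X|)%N.
  by rewrite -(leq_add2l #|X :&: T|) cardsID setIC cardsID.
have [E sE cE] := exists_subset_card _ _ _ cD.
have dE : [disjoint X :&: T & E].
  rewrite -setI_eq0; apply/eqP/setP => i; rewrite !inE; apply/negP.
  by case/andP=> /andP[iX _] /(subsetP sE); rewrite inE iX.
exists ((X :&: T) :|: E); split.
- by rewrite subUset subsetIr (subset_trans sE) ?subsetDl.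
- by rewrite cardsU (disjoint_setI0 dE) cards0 subn0 cE cardsID.
rewrite (big_setID T)/= [leRHS](eq_bigl [in [predU X :&: T & E]]); last first.
  by move=> i; rewrite !inE.
rewrite bigU//= lerD2l.
have [D0|Dgt0] := posnP #|X :\: T|.
  by rewrite (cards0_eq D0) (cards0_eq (etrans cE D0)) !big_set0.
(* Scaled by the common cardinality of [X :\: T] and [E], both sides become double sums over pairs
   from these sets, comparable term by term. *)
rewrite -(ler_pMn2r Dgt0) -{1}cE. rewrite -!sumr_const exchange_big/=.
apply: ler_sum => j; rewrite inE => /andP[jT _].
by apply: ler_sum => i /(subsetP sE); rewrite inE => /andP[_ iT]; exact: topT.
Qed.

(** After the exchange, nonnegativity lets the set grow to the whole top set. *)
Lemma topk_ge {R : realDomainType} (n k : nat) (f : 'I_n -> R) (A : {set 'I_n}) :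
  (k <= n)%N -> (forall i, 0 <= f i) -> (#|A| <= k)%N ->
  \sum_(i in A) f i <= topk k [seq f i | i <- enum 'I_n].
Proof.
move=> kn f0 cA; have [T [cT topT ->]] := topk_top_set n k f kn.
have [|A' [sA' _ /le_trans]] := sum_le_top_set _ f T A topT; first by rewrite cT.
apply; rewrite [leRHS](big_setID A')/= (setIidPr sA') lerDl.
exact: sumr_ge0.
Qed.

(** In this form, a maximum of finitely many finite sums, [topk] is visibly measurable in the
    values; [I] supplies the starting value of the maximum. *)
Lemma topk_bigmax {R : realDomainType} (n k : nat) (f : 'I_n -> R) (I : {set 'I_n}) :
  #|I| = k ->
  topk k [seq f i | i <- enum 'I_n] =
  \big[Num.max/(\sum_(i in I) f i)]_(A : {set 'I_n} | #|A| == k) \sum_(i in A) f i.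
Proof.
move=> cI; have kn : (k <= n)%N by rewrite -cI -[leqRHS]card_ord max_card.
have [T [cT topT ->]] := topk_top_set n k f kn.
have leT (A : {set 'I_n}) : #|A| = k -> \sum_(i in A) f i <= \sum_(i in T) f i.
  move=> cA; have [|A' [sA' cA' /le_trans]] := sum_le_top_set _ f T A topT.
    by rewrite cA cT.
  by apply; have /eqP -> : A' == T by rewrite eqEcard sA' cA' cA cT leqnn.
apply/eqP; rewrite eq_le; apply/andP; split.
  by apply: (le_bigmax_cond _ (fun A : {set 'I_n} => \sum_(i in A) f i)); rewrite cT.
by apply: bigmax_le => [|A /eqP]; exact: leT.
Qed.

(** * Averaging over the [k]-sets on a fixed profile *)

Lemma exists_inj_onto_set (I : finType) (A B : {set I}) : #|A| = #|B| ->
  exists2 s : I -> I, injective s & s @: A = B.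
Proof.
(* [enc X] lists [X] first and its complement after it. Matching positions in [enc A] and [enc B]
   sends [A] to [B] since their sizes agree; the default of [nth] is never reached. *)
move=> cAB; pose enc (X : {set I}) := enum X ++ enum (~: X).
have enc_uniq X : uniq (enc X).
  rewrite cat_uniq !enum_uniq andbT; apply/hasPn => i.
  by rewrite !mem_enum inE.
have mem_enc X i : i \in enc X by rewrite mem_cat !mem_enum inE orbN.
have size_enc X : size (enc X) = #|I| by rewrite size_cat -!cardE cardsC.
have lt_index X Y i : (index i (enc X) < size (enc Y))%N.
  by rewrite size_enc -(size_enc X) index_mem.
pose s i := nth i (enc B) (index i (enc A)).
have s_inj : injective s.
  move=> i j; rewrite /s (set_nth_default i)// => /eqP.
  rewrite nth_uniq// => /eqP eij.
  by rewrite -(nth_index i (mem_enc A i)) eij nth_index.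
exists s => //; apply/eqP; rewrite eqEcard card_imset// cAB leqnn andbT.
apply/subsetP => _ /imsetP[i iA ->].
rewrite /s index_cat mem_enum iA nth_cat.
have -> : (index i (enum A) < size (enum B))%N.
  by rewrite -cardE -cAB cardE index_mem mem_enum.
by rewrite -mem_enum mem_nth// -cardE -cAB cardE index_mem mem_enum.
Qed.

Section averaging.
Context {R : realDomainType} (n k : nat) (o v : 'I_n -> R) (I T X Y : {set 'I_n}).
Hypotheses (o0 : forall i, 0 <= o i) (v0 : forall i, 0 <= v i).
Hypotheses (cI : #|I| = k) (cT : #|T| = k).
Hypothesis topI : forall i j, i \in I -> j \notin I -> o j <= o i.
Hypothesis topT : forall i j, i \in T -> j \notin T -> v j <= v i.
Hypothesis cXY : (#|X| + #|Y| <= k)%N.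

(** Instead of changing the fixed set, the ad values are permuted: the ad values lost to organic
    slots are then those indexed by [s @: I], while [I] remains the top organic set. *)
Let L (s : 'I_n -> 'I_n) :=
  [seq (if i \in I then o i else v (s i)) | i <- enum 'I_n].

Let kn : (k <= n)%N.
Proof. by rewrite -cI -[leqRHS]card_ord max_card. Qed.

Let L0 s i : 0 <= (if i \in I then o i else v (s i)).
Proof. by case: ifP. Qed.

(** By exchange, [X] moves into [T] and [Y] into [I]. Since [s @: I] misses [T], the items carrying
    the ads of [X'] lie outside [I], so all these ads and organic items can be displayed
    together. *)
Lemma topk_ge_disjoint (s : 'I_n -> 'I_n) : injective s ->
  s @: I \subset ~: T -> \sum_(i in X) v i + \sum_(i in Y) o i <= topk k (L s).
Proof.
move=> s_inj sIT.
have [|X' [sX' cX' leX]] := sum_le_top_set _ v T X topT.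
  by rewrite cT (leq_trans _ cXY)// leq_addr.
have [|Y' [sY' cY' leY]] := sum_le_top_set _ o I Y topI.
  by rewrite cI (leq_trans _ cXY)// leq_addl.
apply: le_trans (lerD leX leY) _.
have notI i : s i \in X' -> i \notin I.
  move=> /(subsetP sX') siT; apply/negP => iI.
  by have /(subsetP sIT) := imset_f s iI; rewrite inE siT.
have dis : [disjoint s @^-1: X' & Y'].
  rewrite disjoints_subset; apply/subsetP => i; rewrite !inE => /notI.
  by apply: contra => /(subsetP sY').
have cA : (#|(s @^-1: X') :|: Y'| <= k)%N.
  by rewrite cardsU (disjoint_setI0 dis) cards0 subn0 card_preimset// cX' cY'.
apply: le_trans (topk_ge _ _ _ _ kn (L0 s) cA).
rewrite [leRHS](eq_bigl [in [predU s @^-1: X' & Y']]); last first.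
  by move=> i; rewrite !inE.
rewrite bigU//= (reindex_inj s_inj)/=; apply: lerD; last first.
  by apply: ler_sum => i /(subsetP sY') ->.
rewrite [leRHS](eq_bigl (fun i => s i \in X')); last by move=> i; rewrite inE.
by apply: ler_sum => i /notI/negbTE ->.
Qed.

(* The [k]-subsets [J] that miss the top set [T] number ['C(n - k, k)]. *)
Lemma topk_sum_ge (s : {set 'I_n} -> 'I_n -> 'I_n) :
  (forall J : {set 'I_n}, #|J| = k -> injective (s J) /\ s J @: I = J) ->
  ('C(n - k, k))%:R * (\sum_(i in X) v i + \sum_(i in Y) o i) <=
  \sum_(J : {set 'I_n} | #|J| == k) topk k (L (s J)).
Proof.
move=> sP; have <- : #|~: T| = (n - k)%N by rewrite cardsCs setCK card_ord cT.
rewrite -cards_draws mulr_natl -sumr_const.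
rewrite [leRHS](bigID (fun J : {set 'I_n} => J \subset ~: T))/=.
(* The [J] that meet [T] contribute at least zero, by [topk_ge] at the empty set. *)
rewrite -[leLHS]addr0; apply: lerD; last first.
  apply: sumr_ge0 => J _.
  by have := topk_ge _ _ _ set0 kn (L0 (s J)); rewrite big_set0 cards0; exact.
rewrite [leLHS](eq_bigl (fun J : {set 'I_n} => (#|J| == k) && (J \subset ~: T))).
  apply: ler_sum => J /andP[/eqP cJ sJ]; have [sJ_inj sJI] := sP _ cJ.
  by apply: topk_ge_disjoint => //; rewrite sJI.
by move=> J; rewrite !inE andbC.
Qed.

End averaging.

(* Imported only here: its set notations shadow those of finset. *)
From mathcomp Require Import all_classical all_reals all_analysis.
From mathcomp Require Import measurable_realfun.
Local Open Scope classical_set_scope.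

(** * The law of a profile and exchangeability *)

Definition profile_space (R : realType) (n : nat) := 'I_n -> R.

HB.instance Definition _ (R : realType) (n : nat) :=
  gen_eqMixin (profile_space R n).
HB.instance Definition _ (R : realType) (n : nat) :=
  gen_choiceMixin (profile_space R n).
HB.instance Definition _ (R : realType) (n : nat) :=
  isPointed.Build (profile_space R n) (fun=> 0).

(** The pi-system generating the product sigma-algebra; independence determines the law of a profile
    on exactly these sets. *)
Definition rectangles (R : realType) (n : nat) : set (set (profile_space R n)) :=
  [set A | exists2 B : 'I_n -> set R, forall i, measurable (B i) &
    A = \bigcap_(i in [set: 'I_n]) [set v : profile_space R n | B i (v i)]].

HB.instance Definition _ (R : realType) (n : nat) := Measurable.copy
  (profile_space R n) (g_sigma_algebraType (rectangles R n)).

Lemma rectanglesI (R : realType) (n : nat) : setI_closed (rectangles R n).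
Proof.
move=> _ _ [A mA ->] [B mB ->]; exists (fun i => A i `&` B i).
  by move=> i; exact: measurableI.
by rewrite -bigcapI.
Qed.

Lemma rectanglesT (R : realType) (n : nat) : rectangles R n setT.
Proof. by exists (fun=> setT) => //; rewrite bigcapT. Qed.

Lemma measurable_coordinate (R : realType) (n : nat) (i : 'I_n) :
  measurable_fun [set: profile_space R n] (fun v : profile_space R n => v i).
Proof.
move=> _ B mB; rewrite setTI; apply: sub_sigma_algebra.
exists (fun j => if j == i then B else setT) => [j|]; first by case: ifP.
apply/seteqP; split => [v vB j _|v /(_ i I)] /=; last by rewrite eqxx.
by case: ifPn => // /eqP ->.
Qed.

Section profile.
Context (d : measure_display) (T : measurableType d) (R : realType) (n : nat).

Lemma measurable_profile (a : 'I_n -> T -> R) :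
  (forall i, measurable_fun setT (a i)) ->
  measurable_fun setT (profile a : T -> profile_space R n).
Proof.
move=> ma; apply: (measurability (rectangles R n)) => //.
move=> _ [_ [B mB ->] <-]; rewrite setTI preimage_bigcap.
apply: fin_bigcap_measurable => // i _.
by rewrite -[X in measurable X]setTI; exact: ma.
Qed.

(** Both integrals are taken against laws pushed forward to the profile space. These finite measures
    agree on a generating pi-system, hence everywhere. *)
Lemma integral_profile_eq (P : probability T R) (a b : 'I_n -> T -> R)
    (F : profile_space R n -> \bar R) :
  (forall i, measurable_fun setT (a i)) ->
  (forall i, measurable_fun setT (b i)) ->
  (forall B : 'I_n -> set R, (forall i, measurable (B i)) ->
    P (\bigcap_(i in [set: 'I_n]) (a i @^-1` B i)) =
    P (\bigcap_(i in [set: 'I_n]) (b i @^-1` B i))) ->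
  measurable_fun [set: profile_space R n] F -> (forall v, (0 <= F v)%E) ->
  (\int[P]_w F (profile a w) = \int[P]_w F (profile b w))%E.
Proof.
move=> /measurable_profile ma /measurable_profile mb ab mF F0.
have push (p : T -> profile_space R n) (mp : measurable_fun setT p) :
    (\int[P]_w F (p w) = \int[pushforward P p]_v F v)%E.
  by rewrite ge0_integral_pushforward.
rewrite (push _ ma) (push _ mb); apply: eq_measure_integral => A mA _.
apply: (measure_unique (rectangles R n) (fun=> setT)) => //.
- exact: rectanglesI.
- by move=> _; exact: rectanglesT.
- by rewrite bigcup_const//; exists 0%N.
- by move=> _ [B mB ->]; exact: ab.
- by move=> _; change (P setT < +oo)%E; rewrite probability_setT ltry.
Qed.

Lemma iid_exchangeable (P : probability T R) (G : probability R R)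
    (a : 'I_n -> T -> R) (s : 'I_n -> 'I_n) (F : profile_space R n -> \bar R) :
  (forall i, measurable_fun setT (a i)) ->
  (forall i A, measurable A -> P (a i @^-1` A) = G A) ->
  mutually_independent P a -> injective s ->
  measurable_fun [set: profile_space R n] F -> (forall v, (0 <= F v)%E) ->
  (\int[P]_w F (profile (a \o s) w) = \int[P]_w F (profile a w))%E.
Proof.
move=> ma aG inda s_inj mF F0; apply: integral_profile_eq => // [i|B mB].
  exact: ma.
(* The inverse [t] turns a rectangle condition on the permuted ads into one on the original ads with
   permuted sides, to which independence applies. *)
have [t st ts] := injF_bij s_inj.
transitivity (P (\bigcap_(i in [set: 'I_n]) (a i @^-1` B (t i)))).
  congr (P _); apply/seteqP; split=> w aB i _; last first.
    by have /= := aB (s i) I; rewrite st.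
  by have /= := aB (t i) I; rewrite ts.
rewrite !inda// (reindex_inj s_inj).
by apply: eq_bigr => i _ /=; rewrite st !aG.
Qed.

End profile.

(** * Measurability of [topk] and truncation at zero *)

Lemma measurable_bigmax {d} {T : measurableType d} {R : realType} (J : Type)
    (D : set T) (r : seq J) (p : pred J) (f0 : T -> R) (f : J -> T -> R) :
  measurable_fun D f0 -> (forall j, measurable_fun D (f j)) ->
  measurable_fun D (fun w => \big[Num.max/f0 w]_(j <- r | p j) f j w).
Proof.
move=> mf0 mf; elim: r => [|j r IH]; first by under eq_fun do rewrite big_nil.
under eq_fun do rewrite big_cons; case: (p j) => //.
exact: (measurable_maxr (mf j) IH).
Qed.

Lemma measurable_topk {d} {T : measurableType d} {R : realType} (n k : nat)
    (f : 'I_n -> T -> R) :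
  (k <= n)%N -> (forall i, measurable_fun setT (f i)) ->
  measurable_fun setT (fun w => topk k [seq f i w | i <- enum 'I_n]).
Proof.
move=> kn mf.
(* The zero function serves to produce some set of [k] indices. *)
have [I [cI _ _]] := topk_top_set n k (fun=> 0 : R) kn.
under eq_fun do rewrite (topk_bigmax _ _ _ _ cI).
by apply: measurable_bigmax => [|A]; under eq_fun do rewrite -big_enum;
  exact: measurable_sum.
Qed.

(** Ad values are nonnegative only almost everywhere; truncation provides integrands that are
    nonnegative at every point. *)
Lemma integral_max0 {d} {T : measurableType d} {R : realType}
    (mu : measure T R) (f : T -> R) :
  measurable_fun setT f -> {ae mu, forall w, 0 <= f w} ->
  (\int[mu]_w (f w)%:E = \int[mu]_w (Num.max 0 (f w))%:E)%E.
Proof.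
move=> mf f0; apply: ae_eq_integral => //.
- exact/measurable_EFinP.
- by apply/measurable_EFinP/measurable_maxr.
- by apply: filterS f0 => w f0 _ /=; rewrite (max_idPr f0).
Qed.

(** * The approximation ratio *)

Theorem theorem3 (R : realType) (d : measure_display) (T : measurableType d)
  (P : probability T R) (n k : nat) (G : probability R R)
  (a : 'I_n -> T -> R) (o : 'I_n -> R) :
  (2 * k <= n)%N ->
  regular G ->
  G [set u : R | u < 0] = 0%E ->
  (forall i, measurable_fun setT (a i)) ->
  (forall i A, measurable A -> P (a i @^-1` A) = G A) ->
  mutually_independent P a ->
  (forall i, 0 <= o i) ->
  forall x y : rule R n,
    is_mechanism k x y ->
    (forall i, measurable [set w | x (profile a w) i]) ->
    (forall i, measurable [set w | y (profile a w) i]) ->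
    ((gfix_ratio R n k)%:E * OBJ P a o x y <= OBJ_GFIX P k a o)%E.
Proof.
move=> nk _ G0 ma aG inda o0 x y [cxy _ _ _] mx my.
have kn : (k <= n)%N by apply: leq_trans nk; rewrite leq_pmull.
have [I [cI topI _]] := topk_top_set n k o kn.
(* A permutation carrying [I] to [J] is chosen for every [k]-set [J]; for other sizes [id] is a
   dummy. *)
have ex_s (J : {set 'I_n}) : exists sJ : 'I_n -> 'I_n,
    #|J| = k -> injective sJ /\ (sJ @: I)%SET = J.
  have [cJ|nJ] := eqVneq #|J| k; last first.
    by exists id => /eqP; rewrite (negbTE nJ).
  have [sJ sJ_inj sJI] := exists_inj_onto_set _ I J (etrans cI (esym cJ)).
  by exists sJ.
have [s sP] := choice ex_s.
pose fix_val (v : profile_space R n) : R := topk k (Lvals I o v).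
have mfix : measurable_fun [set: profile_space R n] fix_val.
  apply: measurable_topk => // i; case: (i \in I) => //.
  exact: measurable_coordinate.
have a0 : {ae P, forall w, forall i, 0 <= a i w}.
  apply: filter_forall => i; exists (a i @^-1` [set u | u < 0]); split.
  - rewrite -[X in measurable X]setTI; apply: ma => //.
    by rewrite -[X in measurable X]set_itvNyo.
  - by rewrite aG// -set_itvNyo.
  - by move=> w /= /negP; rewrite -ltNge.
have fix0 : {ae P, forall w, 0 <= fix_val (profile a w)}.
  apply: filterS a0 => w aw0.
  have := topk_ge _ k (fun i => if i \in I then o i else a i w) finset.set0 kn.
  by rewrite big_set0 cards0; apply=> // i; case: ifP.
pose u w := \sum_(i < n) (a i w * (x (profile a w) i)%:R
                          + o i * (y (profile a w) i)%:R).
have mu : measurable_fun setT u.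
  apply: measurable_sum => i; apply: measurable_funD; apply: measurable_funM => //.
    have -> : (fun w => (x (profile a w) i)%:R) =
        \1_[set w | x (profile a w) i] :> (T -> R).
      by apply/funext => w; rewrite indicE mem_setE.
    exact: measurable_indic.
  have -> : (fun w => (y (profile a w) i)%:R) =
      \1_[set w | y (profile a w) i] :> (T -> R).
    by apply/funext => w; rewrite indicE mem_setE.
  exact: measurable_indic.
have u0 : {ae P, forall w, 0 <= u w}.
  by apply: filterS a0 => w aw0; apply: sumr_ge0 => i _;
     rewrite addr_ge0// mulr_ge0.
pose F v : \bar R := (Num.max 0 (fix_val v))%:E.
have F0 v : (0 <= F v)%E by rewrite lee_fin le_max lexx.
have mF : measurable_fun [set: profile_space R n] F.
  by apply/measurable_EFinP/measurable_maxr.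
have mFJ J : measurable_fun setT (fun w => F (profile (a \o s J) w)).
  by apply: (measurableT_comp mF); apply: measurable_profile => i; exact: ma.
have fixE : OBJ_FIX P k a o I = (\int[P]_w F (profile a w))%E.
  rewrite -integral_max0//; apply: (measurableT_comp mfix).
  exact: measurable_profile.
(* [topk_sum_ge] is applied at almost every profile. The top ad set varies with the profile, but the
   number of [J] missing it does not, so the binomial factor is a constant of the integral. *)
have le_sum : ('C(n - k, k)%:R%:E * \int[P]_w (Num.max 0 (u w))%:E <=
    \sum_(J : {set 'I_n} | #|J| == k) \int[P]_w F (profile (a \o s J) w))%E.
  rewrite -ge0_integralZl//; last 2 first.
  - by apply/measurable_EFinP/measurable_maxr.
  - by move=> w _; rewrite lee_fin le_max lexx.
  rewrite -big_filter -ge0_integral_sum//.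
  apply: ae_ge0_le_integral => //.
  - by move=> w _; rewrite -EFinM lee_fin mulr_ge0// le_max lexx.
  - by apply: measurable_funeM; apply/measurable_EFinP/measurable_maxr.
  - by move=> w _; exact: sume_ge0.
  - exact: emeasurable_sum.
  apply: filterS2 a0 u0 => w aw0 uw0 _.
  rewrite (max_idPr uw0) -EFinM sumEFin lee_fin big_filter.
  have [A [cA topA _]] := topk_top_set n k (fun i => a i w) kn.
  pose X := [set i | x (profile a w) i]%SET.
  pose Y := [set i | y (profile a w) i]%SET.
  have uE : u w = \sum_(i in X) a i w + \sum_(i in Y) o i.
    rewrite /u big_split/=; congr (_ + _); rewrite [RHS]big_mkcond;
      by apply: eq_bigr => i _; rewrite inE mulr_natr; case: ifP.
  have cXY : (#|X| + #|Y| <= k)%N.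
    apply: leq_trans (cxy (profile a w)); rewrite -!sum1_card big_split/=.
    by rewrite big_mkcond [X in (_ + X)%N]big_mkcond leq_add//;
      apply: leq_sum => i _; rewrite inE; case: ifP.
  rewrite uE.
  apply: le_trans (topk_sum_ge _ _ _ _ _ _ _ _ o0 aw0 cI cA topI topA cXY s sP) _.
  by apply: ler_sum => J _; rewrite le_max lexx orbT.
(* By exchangeability all ['C(n, k)] integrals equal the value of G-FIX-[I]; dividing by their
   number gives the ratio. *)
have exch (J : {set 'I_n}) : #|J| == k ->
    (\int[P]_w F (profile (a \o s J) w) = OBJ_FIX P k a o I)%E.
  move=> /eqP cJ; rewrite fixE; have [sJ_inj _] := sP _ cJ.
  exact: (iid_exchangeable _ _ _ _ P G).
rewrite (eq_bigr _ exch) big_const -cardsE card_draws card_ord in le_sum.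
have CE : 0 < 'C(n, k)%:R :> R by rewrite ltr0n bin_gt0.
apply: (@le_trans _ _ (OBJ_FIX P k a o I)); last first.
  apply: (le_bigmax_cond _ (fun I : {set 'I_n} => OBJ_FIX P k a o I)).
  by rewrite cI.
rewrite /OBJ -/u integral_max0// /gfix_ratio mulrC EFinM -muleA.
by rewrite lee_pdivrMl// [leRHS]mule_natl /enatmul Monoid.iteropE.
Qed.
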